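(* Let $K$ be a quadratic imaginary number field whose ring of integers $\mathcal{O}_K$ is a principal ideal domain but is not Euclidean, and let $n\ge 2$. Then the Steinberg module $\mathsf{St}_n(K)$ is not generated by integral apartment classes.
   Context: Let $K$ be a number field with ring of integers $\mathcal{O}_K$. The Tits building $\mathcal{T}_n(K)$ is the geometric realization of the poset of proper non-zero subspaces of $K^n$ ordered by inclusion, and the Steinberg module is $\mathsf{St}_n(K):=\widetilde H_{n-2}(\mathcal{T}_n(K))$ (reduced integral homology), a $\mathrm{GL}_n(K)$-representation. Let $\vec L$ denote a decomposition $K^n=L_1\oplus\cdots\oplus L_n$ into lines. Let $A_{\vec L}$ be the full subcomplex of $\mathcal{T}_n(K)$ whose vertices are the direct sums of proper non-empty subsets of $\{L_1,\dots,L_n\}$. It is homeomorphic to an $(n-2)$-sphere and is called an apartment; the images in $\mathsf{St}_n(K)$ of the two choices of fundamental class of $A_{\vec L}$ are called apartment classes. The apartment (or apartment class) is integral if $\mathcal{O}_K^n=(\mathcal{O}_K^n\cap L_1)\oplus\cdots\oplus(\mathcal{O}_K^n\cap L_n)$. ''Generated by integral apartment classes'' means that the integral apartment classes generate the whole abelian group $\mathsf{St}_n(K)$. *)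

(* Defs.v *)
From HB Require Import structures.
From mathcomp Require Import all_boot all_order all_algebra all_field.
From mathcomp Require Import boolp.
From mathcomp Require Import freeg zify.

Set Implicit Arguments.
Unset Strict Implicit.
Unset Printing Implicit Defensive.

Import Order.TTheory GRing.Theory Num.Theory.

Local Open Scope ring_scope.
Local Open Scope quotient_scope.

Fact scale_int (V : lmodType int) (a : int) (v : V) : a *: v = v *~ a.
Proof. by rewrite -scaler_int intz. Qed.

Section Simplices.

Variables (d : Order.disp_t) (P : porderType d).

(* The simplices of the order complex of P having m vertices are the families
   x_0 < ... < x_(m-1).  There is exactly one for m = 0, the empty simplex:
   the chain complex below is augmented, and its homology is reduced. *)
Definition increasing m (x : {ffun 'I_m -> P}) :=
  [forall i : 'I_m, forall j : 'I_m, (i < j)%N ==> (x i < x j)%O].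

Lemma increasingP m (x : {ffun 'I_m -> P}) :
  reflect (forall i j : 'I_m, (i < j)%N -> (x i < x j)%O) (increasing x).
Proof.
apply: (iffP forallP) => [x_lt i j|x_lt i].
  by move/forallP: (x_lt i) => /(_ j) /implyP.
by apply/forallP => j; apply/implyP; apply: x_lt.
Qed.

Record simplex m := Simplex {
  vertices : {ffun 'I_m -> P};
  _ : increasing vertices
}.

HB.instance Definition _ m := [isSub of simplex m for @vertices m].
HB.instance Definition _ m := [Choice of simplex m by <:].

Lemma face_subproof m (i : 'I_m.+1) (s : simplex m.+1) :
  increasing [ffun j : 'I_m => vertices s (fintype.lift i j)].
Proof.
apply/increasingP => j k jk; rewrite !ffunE.
apply: (increasingP _ (valP s)); rewrite /= /bump.
case: (leqP i j) => [ij|_]; first by rewrite (leq_trans ij (ltnW jk)) ltnS.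
by rewrite add0n (leq_trans jk) // leq_addl.
Qed.

Definition face m (i : 'I_m.+1) (s : simplex m.+1) : simplex m :=
  Simplex (face_subproof i s).

Definition chain m := {freeg (simplex m) / int}.

Definition boundary m : chain m.+1 -> chain m :=
  fglift (fun s => \sum_(i < m.+1) << (-1) ^+ i *g face i s >>).

Fact boundary_is_additive m : zmod_morphism (@boundary m).
Proof. exact: lift_is_additive. Qed.

HB.instance Definition _ m :=
  GRing.isZmodMorphism.Build _ _ (@boundary m) (@boundary_is_additive m).

Lemma face_face m (i : 'I_m.+2) (j : 'I_m.+1) (i' : 'I_m.+2) (j' : 'I_m.+1)
    (s : simplex m.+2) :
  (j < i)%N -> i' = j :> nat -> j'.+1 = i :> nat ->
  face j (face i s) = face j' (face i' s).
Proof.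
move=> ji i'E j'E; apply/val_inj/ffunP => l; rewrite !ffunE.
congr (vertices s _); apply/val_inj; rewrite /= /bump i'E.
have {}j'E : (j' : nat) = i.-1 by rewrite -j'E.
rewrite j'E; move: (val l) (val i) (val j) ji => a b c {i'E j'E}; lia.
Qed.

Lemma boundary_boundary m (c : chain m.+2) : boundary (boundary c) = 0.
Proof.
rewrite -[c]freeg_sumE !raddf_sum big1 // => s _ /=.
rewrite [boundary << _ *g s >>]liftU scale_int raddfMz.
rewrite [X in X *~ _](_ : _ = 0) ?mul0rz // raddf_sum /=.
pose F (i : 'I_m.+2) (j : 'I_m.+1) : chain m :=
  << (-1) ^+ (i + j) *g face j (face i s) >>.
rewrite (eq_bigr (fun i => \sum_(j < m.+1) F i j)); last first.
  move=> i _; rewrite [LHS]liftU scaler_sumr; apply: eq_bigr => j _.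
  by rewrite scale_int freeg_mulz -mulrzl intz -exprD.
rewrite (eq_bigr (fun i : 'I_m.+2 => \sum_(j < m.+1 | (j < i)%N) F i j
                           + \sum_(j < m.+1 | ~~ (j < i)%N) F i j)); last first.
  by move=> i _; rewrite (bigID (fun j : 'I_m.+1 => (j < i)%N)).
rewrite big_split /= !pair_big_dep /=.
pose h (p : 'I_m.+2 * 'I_m.+1) : 'I_m.+2 * 'I_m.+1 :=
  (inord p.2, inord p.1.-1).
pose g (p : 'I_m.+2 * 'I_m.+1) : 'I_m.+2 * 'I_m.+1 :=
  (inord p.2.+1, inord p.1).
rewrite addrC (reindex_onto h g) /=; last first.
  move=> [i j] /= ij; have := ltn_ord i; have := ltn_ord j => jm im.
  by congr (_, _); apply/val_inj; rewrite /= !inordK //=; lia.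
rewrite [X in X + _](eq_bigl (fun p : 'I_m.+2 * 'I_m.+1 => (p.2 < p.1)%N)).
  rewrite -big_split /= big1 // => -[i j] /= ji.
  have := ltn_ord i; have := ltn_ord j => jm im.
  rewrite /F (@face_face _ i j (inord j) (inord i.-1)) ?inordK //; try lia.
  rewrite freegUD (_ : _ + _ = 0) ?freegU0 //.
  rewrite -[X in _ ^+ (X + j)%N](@prednK i) ?(leq_ltn_trans _ ji) //.
  by rewrite addSn exprS mulN1r addnC subrr.
move=> [i j] /=; have := ltn_ord i; have := ltn_ord j => jm im.
rewrite /h /g /= xpair_eqE -!val_eqE /=.
have [ji|ij] := ltnP j i; rewrite ?inordK; try lia.
Qed.

End Simplices.

Section ReducedHomology.

Variables (d : Order.disp_t) (P : porderType d) (k : nat).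

(* k is the homological degree: a k-simplex has k.+1 vertices. *)
Definition is_cycle : {pred chain P k.+1} := fun z => boundary z == 0.

Fact is_cycle_zmod_closed : zmod_closed is_cycle.
Proof.
split=> [|x y]; rewrite !unfold_in ?raddf0 //.
by move=> /eqP x0 /eqP y0; rewrite raddfB /= x0 y0 subrr.
Qed.

HB.instance Definition _ :=
  GRing.isZmodClosed.Build (chain P k.+1) is_cycle is_cycle_zmod_closed.

Record cycles := Cycle { cycle_chain : chain P k.+1; _ : cycle_chain \in is_cycle }.

HB.instance Definition _ := [isSub of cycles for cycle_chain].
HB.instance Definition _ := [Choice of cycles by <:].
HB.instance Definition _ := [SubChoice_isSubZmodule of cycles by <:].

Definition boundaries : {pred cycles} :=
  fun z => `[< exists c : chain P k.+2, boundary c = cycle_chain z >].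

Fact boundaries_zmod_closed : zmod_closed boundaries.
Proof.
split=> [|x y]; rewrite !unfold_in.
  by apply/asboolP; exists 0; rewrite raddf0.
move=> /asboolP[a ax] /asboolP[b bx]; apply/asboolP.
by exists (a - b); rewrite raddfB /= ax bx.
Qed.

HB.instance Definition _ :=
  GRing.isZmodClosed.Build cycles boundaries boundaries_zmod_closed.

Definition reduced_homology := {ideal_quot boundaries}.

HB.instance Definition _ := Choice.on reduced_homology.
HB.instance Definition _ := GRing.Zmodule.on reduced_homology.

End ReducedHomology.

Section InducedMap.

Variables (d : Order.disp_t) (P : porderType d).
Variables (d' : Order.disp_t) (Q : porderType d').
Variables (f : P -> Q) (f_lt : {homo f : x y / (x < y)%O}).

Lemma simplex_map_subproof m (s : simplex P m) :
  increasing [ffun j : 'I_m => f (vertices s j)].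
Proof.
apply/increasingP => i j ij; rewrite !ffunE.
exact: f_lt (increasingP _ (valP s) i j ij).
Qed.

Definition simplex_map m (s : simplex P m) : simplex Q m :=
  Simplex (simplex_map_subproof s).

Definition chain_map m : chain P m -> chain Q m :=
  fglift (fun s => << 1 *g simplex_map s >>).

Fact chain_map_is_additive m : zmod_morphism (@chain_map m).
Proof. exact: lift_is_additive. Qed.

HB.instance Definition _ m :=
  GRing.isZmodMorphism.Build _ _ (@chain_map m) (@chain_map_is_additive m).

Lemma simplex_map_face m (i : 'I_m.+1) (s : simplex P m.+1) :
  simplex_map (face i s) = face i (simplex_map s).
Proof. by apply/val_inj/ffunP => j; rewrite !ffunE. Qed.

Lemma chain_map_boundary m (c : chain P m.+1) :
  boundary (chain_map c) = chain_map (boundary c).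
Proof.
rewrite -[c]freeg_sumE !raddf_sum; apply: eq_bigr => s _ /=.
rewrite [chain_map _]liftU [boundary (<< _ *g s >>)]liftU !scale_int !raddfMz.
congr (_ *~ _); rewrite [LHS]liftU scale1r raddf_sum; apply: eq_bigr => i _.
by rewrite /= [RHS]liftU scale_int simplex_map_face freeg_mulz intz.
Qed.

Lemma cycle_map_subproof k (z : cycles P k) :
  chain_map (cycle_chain z) \in @is_cycle _ Q k.
Proof.
by rewrite unfold_in chain_map_boundary (eqP (valP z : boundary _ == 0)) raddf0.
Qed.

Definition cycle_map k (z : cycles P k) : cycles Q k :=
  Cycle (cycle_map_subproof z).

(* By homology_map_pi below, this does not depend on the cycle chosen by repr. *)
Definition homology_map k (x : reduced_homology P k) : reduced_homology Q k :=
  \pi_(reduced_homology Q k) (cycle_map (repr x)).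

Lemma homology_map_pi k (z : cycles P k) :
  homology_map (\pi_(reduced_homology P k) z)
  = \pi_(reduced_homology Q k) (cycle_map z).
Proof.
apply/eqP; rewrite -Quotient.idealrBE.
set y := repr _; have : y = z %[mod reduced_homology P k] by rewrite reprK.
move/eqP; rewrite -Quotient.idealrBE => /asboolP[c cE]; apply/asboolP.
exists (chain_map c); rewrite chain_map_boundary cE /=.
exact: raddfB.
Qed.

End InducedMap.

Section TitsBuilding.

Variables (K : fieldType) (n : nat).

(* The vertices of the Tits building of K^n. *)
Record tits := Tits {
  subspace : {vspace 'rV[K]_n};
  _ : (subspace != 0%VS) && (subspace != fullv)
}.

HB.instance Definition _ := [isSub of tits for subspace].
HB.instance Definition _ := [Choice of tits by <:].

Fact tits_display : Order.disp_t. Proof. exact: Order.Disp tt tt. Qed.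

Definition tits_le (U V : tits) := (subspace U <= subspace V)%VS.

Fact tits_le_refl : reflexive tits_le.
Proof. by move=> U; apply: subvv. Qed.

Fact tits_le_anti : antisymmetric tits_le.
Proof. by move=> U V UV; apply/val_inj/eqP; rewrite eqEsubv. Qed.

Fact tits_le_trans : transitive tits_le.
Proof. by move=> V U W; apply: subv_trans. Qed.

HB.instance Definition _ :=
  Order.Le_isPOrder.Build tits_display tits
    tits_le_refl tits_le_anti tits_le_trans.

Definition line_decomposition (L : 'I_n -> {vspace 'rV[K]_n}) : Prop :=
  [/\ forall i, \dim (L i) = 1%N,
      directv (\sum_i L i)
    & (\sum_i L i)%VS = fullv].

Record apartment (L : 'I_n -> {vspace 'rV[K]_n}) := Apartment {
  apartment_vertex : tits;
  _ : [exists I : {set 'I_n},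
        [&& I != set0, I != [set: 'I_n]
          & subspace apartment_vertex == (\sum_(i in I) L i)%VS]]
}.

HB.instance Definition _ L := [isSub of apartment L for @apartment_vertex L].
HB.instance Definition _ L := [Choice of apartment L by <:].
HB.instance Definition _ L :=
  [SubChoice_isSubPOrder of apartment L by <: with tits_display].

Fact apartment_vertex_lt L :
  {homo @apartment_vertex L : U V / (U < V)%O}.
Proof. by []. Qed.

(* The homological degree n - 2 is meant for n >= 2. *)
Definition steinberg := reduced_homology tits (n - 2).

HB.instance Definition _ := Choice.on steinberg.
HB.instance Definition _ := GRing.Zmodule.on steinberg.

(* A fundamental class of the (n-2)-sphere A_L is a generator of its infinite
   cyclic top homology group. *)
Definition fundamental_class L (u : reduced_homology (apartment L) (n - 2)) :=
  forall v, exists a : int, v = u *~ a.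

Definition apartment_class L (x : steinberg) :=
  exists2 u, fundamental_class u & x = homology_map (@apartment_vertex_lt L) u.

End TitsBuilding.

Definition generated_by (V : zmodType) (S : V -> Prop) : Prop :=
  forall x : V, exists (m : nat) (a : 'I_m -> int) (s : 'I_m -> V),
    (forall j, S (s j)) /\ x = \sum_j s j *~ a j.

Section RingProperties.

Variable R : comNzRingType.

Definition integral_domain : Prop :=
  forall x y : R, x * y = 0 -> x = 0 \/ y = 0.

Definition is_ideal (I : R -> Prop) : Prop :=
  [/\ I 0, forall x y, I x -> I y -> I (x + y) & forall a x, I x -> I (a * x)].

Definition principal_ideal_domain : Prop :=
  integral_domain /\
  forall I : R -> Prop, is_ideal I ->
    exists a, forall x, I x <-> exists b, x = b * a.

Definition euclidean_domain : Prop :=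
  integral_domain /\
  exists N : R -> nat, forall a b : R, b != 0 ->
    exists q r : R, a = q * b + r /\ (r = 0 \/ (N r < N b)%N).

End RingProperties.

Section RingOfIntegers.

Variable K : fieldExtType rat.

Definition imaginary_quadratic : Prop :=
  \dim {:K} = 2%N /\
  exists (D : int) (x : K), D < 0 /\ x ^+ 2 = D%:~R.

Definition alg_integer : {pred K} :=
  fun x => `[< integralOver (intr : int -> K) x >].

Fact alg_integer_subring : subring_closed alg_integer.
Proof.
split=> [|x y|x y]; rewrite !unfold_in.
- by apply/asboolP; apply: integral1.
- by move=> /asboolP xi /asboolP yi; apply/asboolP; apply: integral_sub.
- by move=> /asboolP xi /asboolP yi; apply/asboolP; apply: integral_mul.
Qed.

HB.instance Definition _ :=
  GRing.isSubringClosed.Build K alg_integer alg_integer_subring.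

Record ring_of_integers :=
  RingOfIntegers { int_val : K; _ : int_val \in alg_integer }.

HB.instance Definition _ := [isSub of ring_of_integers for int_val].
HB.instance Definition _ := [Choice of ring_of_integers by <:].
HB.instance Definition _ :=
  [SubChoice_isSubComNzRing of ring_of_integers by <:].

Variable n : nat.

(* Membership in the lattice O_K^n of K^n. *)
Definition integral_vector (v : 'rV[K]_n) : Prop :=
  forall j, v 0 j \in alg_integer.

(* O_K^n is the internal direct sum of its intersections with the L_i. *)
Definition integral_decomposition (L : 'I_n -> {vspace 'rV[K]_n}) : Prop :=
  forall v, integral_vector v ->
    exists! w : {ffun 'I_n -> 'rV[K]_n},
      (forall i, integral_vector (w i) /\ w i \in L i) /\ v = \sum_i w i.

Definition integral_apartment_class (x : steinberg K n) : Prop :=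
  exists L : 'I_n -> {vspace 'rV[K]_n},
    [/\ line_decomposition L, integral_decomposition L & apartment_class L x].

End RingOfIntegers.

(* Main.v *)
Require Import Defs.
From HB Require Import structures.
From mathcomp Require Import all_boot all_order all_algebra all_field.
From mathcomp Require Import fingroup perm.
From mathcomp Require Import boolp freeg zify ring lra.

Set Implicit Arguments.
Unset Strict Implicit.
Unset Printing Implicit Defensive.

Import Order.TTheory GRing.Theory Num.Theory.

Local Open Scope ring_scope.
Local Open Scope quotient_scope.

(** Write e_0, e_1, ... for the standard basis of K^n and call two lines of the
    plane spanned by e_0 and e_1 adjacent when the vectors with coordinates in
    O_K of the plane are the direct sum of those of the two lines.  The proof
    has an arithmetic half, about this graph, and a topological half.

    Arithmetic.  As O_K is not Euclidean, some w in K has distance at least 1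
    to every element of O_K, and every element of O_K other than 0, 1 and -1
    has absolute value at least 2: an integer z violating this would make the
    lattice spanned by 1 and z (or by 1 and (1 + z) / 2) dense enough for
    division with remainder.  A path from <e_0> in the graph is a continued
    fraction with partial quotients in O_K; partial quotients 0, 1 and -1 can
    be eliminated, and when all the others have absolute value at least 2, the
    denominators q grow by at least 1 at each step while the convergents p / q
    stay at distance at most 1 - 1 / |q| from an element of O_K.  Hence no path
    leads from <e_0> to the line through w e_0 + e_1 ([unreached_line]),
    whereas the connected component C of <e_0> is closed under adjacency
    ([reached_integral_apartment]).

    Topology.  Fix a complete flag of K^n and let its line vary within its
    plane <e_0, e_1>.  Send an (n-2)-cycle of the Tits building to the sum of
    its coefficients at those of the resulting flags whose line lies in C
    ([detect]).  There are no simplices of dimension n - 1, so this is a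
    functional on the Steinberg module.  A cycle supported on one apartment has
    total coefficient 0 on all these flags, because its boundary vanishes at
    the flag deprived of its line; and if the apartment is integral, the at
    most two lines involved are adjacent, hence both in C or both outside C.
    So the functional kills all integral apartment classes
    ([detect_apartment]).  It takes the value -1 on the apartment of the
    frame (w e_0 + e_1, e_0, e_2, ..., e_(n-1)), one of whose first two lines
    is in C and the other not ([detect_apartment_cycle]). *)

(** * The complex absolute value on an imaginary quadratic field *)

(** K is embedded in [algC] so as to have an absolute value satisfying the
    triangle inequality; coordinates in the basis 1, x keep squared absolute
    values in the ordered field [rat], where they can be estimated. *)
Lemma quadratic_coordinates (K : fieldExtType rat) (D : int) (x : K) :
  \dim {:K} = 2%N -> D < 0 -> x ^+ 2 = D%:~R ->
  exists f : {rmorphism K -> algC},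
    (forall z, exists a b : rat, z = a%:A + b *: x) /\
    (forall a b : rat,
       `|f (a%:A + b *: x)| ^+ 2 = ratr (a ^+ 2 - D%:~R * b ^+ 2)
       /\ f (a%:A + b *: x) + (f (a%:A + b *: x))^* = ratr (2 * a)).
Proof.
move=> dimK D_lt0 x2.
have D_Q : (D%:~R : K) = (D%:~R : rat)%:A by rewrite alg_num_field ratr_int.
have free_1x : free [tuple 1; x].
  rewrite free_cons span_seq1 seq1_free andbC.
  have x_notin1 : x \notin 1%VS.
    apply/negP => /vlineP[a xE].
    have /eqP : (a ^+ 2)%:A = (D%:~R : rat)%:A :> K.
      by rewrite -D_Q -x2 xE exprZn expr1n.
    rewrite -subr_eq0 -scalerBl scaler_eq0 oner_eq0 orbF subr_eq0 => /eqP aD.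
    have := sqr_ge0 a; rewrite aD ler0z; lia.
  apply/andP; split; first by apply: contraNneq x_notin1 => ->; rewrite mem0v.
  apply: contra x_notin1 => /vlineP[a aE]; apply/vlineP.
  have a0 : a != 0 by apply: contra_eq_neq aE => ->; rewrite scale0r oner_eq0.
  by exists a^-1; rewrite aE scalerA mulVf // scale1r.
have basis_1x : basis_of fullv [tuple 1; x].
  by rewrite basisEfree free_1x subvf dimK.
pose re (z : K) : rat := coord [tuple 1; x] 0 z.
pose im (z : K) : rat := coord [tuple 1; x] 1 z.
have zE z : z = (re z)%:A + im z *: x.
  rewrite {1}[z](coord_basis basis_1x (memvf z)) big_ord_recl big_ord1 /=.
  by congr (_ + coord _ _ _ *: _); apply/val_inj.
have coordE a b : re (a%:A + b *: x) = a /\ im (a%:A + b *: x) = b.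
  have -> : a%:A + b *: x =
     \sum_(i < 2) [ffun i : 'I_2 => if i == 0 then a else b] i *: [tuple 1; x]`_i.
    by rewrite big_ord_recl big_ord1 !ffunE.
  by rewrite /re /im !coord_sum_free // !ffunE.
(* The image of x: a square root of D that complex conjugation negates. *)
pose s : algC := 'i * sqrtC (- D%:~R).
have s2 : s ^+ 2 = D%:~R by rewrite exprMn sqrCi sqrtCK mulN1r opprK.
have s_conj : s^* = - s.
  rewrite rmorphM /= conjCi mulNr conj_Creal //.
  by rewrite ger0_real // sqrtC_ge0 oppr_ge0 lerz0 ltW.
pose f z : algC := ratr (re z) + ratr (im z) * s.
have f_add : zmod_morphism f.
  move=> y z; rewrite /f /re /im !linearB !rmorphB; ring.
have f_mul : monoid_morphism f.
  split=> [|y z].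
    have [r i] := coordE 1 0.
    rewrite scale0r addr0 scale1r in r i.
    by rewrite /f r i rmorph1 rmorph0 mul0r addr0.
  rewrite [in LHS](zE y) [in LHS](zE z).
  have -> : ((re y)%:A + im y *: x) * ((re z)%:A + im z *: x)
     = (re y * re z + D%:~R * (im y * im z))%:A + (re y * im z + im y * re z) *: x.
    by rewrite -!(mulr_algl _ x) -!in_algE !(rmorphD, rmorphM) rmorph_int -x2 /=; ring.
  have [r i] := coordE (re y * re z + D%:~R * (im y * im z))
                       (re y * im z + im y * re z).
  rewrite /f r i !(rmorphD, rmorphM) /= ratr_int -s2; ring.
pose fa := GRing.isZmodMorphism.Build _ _ f f_add.
pose fm := GRing.isMonoidMorphism.Build _ _ f f_mul.
pose F : {rmorphism K -> algC} := HB.pack f fa fm.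
exists F; split=> [z|a b]; first by exists (re z), (im z).
have FE : F (a%:A + b *: x) = ratr a + ratr b * s.
  by rewrite [F _]/(f _) /f; have [-> ->] := coordE a b.
have F_conj : (F (a%:A + b *: x))^* = ratr a - ratr b * s.
  have ratr_conj (q : rat) : (ratr q : algC)^* = ratr q.
    by rewrite conj_Creal // Creal_Crat // rpred_rat.
  rewrite FE rmorphD [X in _ + X]rmorphM [X in _ * X]s_conj mulrN.
  by congr (_ - _ * _); apply: ratr_conj.
rewrite normCK F_conj FE; split.
  by rewrite !(rmorphB, rmorphM, rmorphXn) /= ratr_int -s2; ring.
by rewrite rmorphM /= ratr_nat; ring.
Qed.

Lemma round_rat (a : rat) : exists m : int, (a - m%:~R) ^+ 2 <= 4^-1.
Proof.
exists (Num.floor (a + 2^-1)).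
have := floor_itv (a + 2^-1); set m := Num.floor _.
rewrite rmorphD /= => /andP[ml mr].
set u := m%:~R in ml mr *; nra.
Qed.

(** A point of the plane is within 1 of the lattice spanned by 1 and
    a1 + b1 sqrt(D) as soon as consecutive horizontal rows of the lattice are
    less than sqrt(3) apart: rounding along the second generator and then along
    the first leaves squared coordinates below 3 / 4 and at most 1 / 4. *)
Lemma lattice_close (D : int) (a1 b1 a b : rat) :
  0 < - D%:~R * b1 ^+ 2 < 3 ->
  exists m n : int, (a - m%:~R - n%:~R * a1) ^+ 2 - D%:~R * (b - n%:~R * b1) ^+ 2 < 1.
Proof.
move=> /andP[b1_gt0 b1_lt3].
have b1_neq0 : b1 != 0 by apply: contraTneq b1_gt0 => ->; rewrite expr0n mulr0.
have [n n_close] := round_rat (b / b1).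
have [m m_close] := round_rat (a - n%:~R * a1).
exists m, n; rewrite [a - _ - _]addrAC.
have -> : b - n%:~R * b1 = (b / b1 - n%:~R) * b1 by field.
rewrite exprMn.
set u := (_ - m%:~R) ^+ 2 in m_close *; set v := (_ - n%:~R) ^+ 2 in n_close *.
have v_ge0 : 0 <= v := sqr_ge0 _.
nra.
Qed.

(** * Imaginary quadratic rings that are not norm-Euclidean *)

Section QuadraticField.

Variables (K : fieldExtType rat) (D : int) (x : K) (f : {rmorphism K -> algC}).
Hypothesis D_lt0 : D < 0.
Hypothesis x2 : x ^+ 2 = D%:~R.
Hypothesis coordinates : forall z : K, exists a b : rat, z = a%:A + b *: x.
Hypothesis normE : forall a b : rat,
  `|f (a%:A + b *: x)| ^+ 2 = ratr (a ^+ 2 - D%:~R * b ^+ 2)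
  /\ f (a%:A + b *: x) + (f (a%:A + b *: x))^* = ratr (2 * a).

Lemma alg_integer_Aint (z : K) : z \in @alg_integer K -> f z \in Aint.
Proof.
rewrite unfold_in => /asboolP[p p_monic p_z].
apply: (root_monic_Aint (p := map_poly intr p)).
- rewrite (_ : map_poly _ p = map_poly f (map_poly intr p)); last first.
    by rewrite -map_poly_comp; apply: eq_map_poly => m /=; rewrite rmorph_int.
  by rewrite rmorph_root.
- exact: monic_map.
- by apply/polyOverP => i; rewrite coef_map /=.
Qed.

Lemma rat_Aint (q : rat) : (ratr q : algC) \in Aint -> exists m : int, q = m%:~R.
Proof.
move=> q_int.
have /intrP[m mE] := Cint_rat_Aint (rpred_rat _ q) q_int.
exists m; apply: (fmorph_inj (@ratr algC)); rewrite [LHS]mE.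
by rewrite rmorph_int.
Qed.

(** Trace and norm are rational, and algebraic integers because the conjugate
    of an algebraic integer is one. *)
Lemma alg_integer_trace_norm (a b : rat) :
  a%:A + b *: x \in @alg_integer K ->
  exists t N : int, 2 * a = t%:~R /\ a ^+ 2 - D%:~R * b ^+ 2 = N%:~R.
Proof.
move=> z_int; have [nE tE] := normE a b.
have fz_int := alg_integer_Aint z_int.
have fzC_int : (f (a%:A + b *: x))^* \in Aint by rewrite Aint_aut.
have [t tZ] : exists t : int, 2 * a = t%:~R.
  by apply: rat_Aint; rewrite -tE rpredD.
have [N NZ] : exists N : int, a ^+ 2 - D%:~R * b ^+ 2 = N%:~R.
  by apply: rat_Aint; rewrite -nE normCK rpredM.
by exists t, N.
Qed.

Definition norm_euclidean :=
  forall w : K, exists2 c, c \in @alg_integer K & `|f (w - c)| < 1.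

Lemma alg_integer_int (m : int) : (m%:~R : K) \in @alg_integer K.
Proof. exact: rpred_int. Qed.

Lemma norm_euclidean_lattice (a1 b1 : rat) :
  a1%:A + b1 *: x \in @alg_integer K -> 0 < - D%:~R * b1 ^+ 2 < 3 ->
  norm_euclidean.
Proof.
move=> z_int b1_small w.
have [a [b ->]] := coordinates w.
have [m [n mn]] := lattice_close a1 a b b1_small.
exists (m%:~R + n%:~R * (a1%:A + b1 *: x)).
  by rewrite rpredD ?rpredM ?alg_integer_int.
rewrite -(@ltr_pXn2r _ 2) ?nnegrE // expr1n.
have -> : a%:A + b *: x - (m%:~R + n%:~R * (a1%:A + b1 *: x))
    = (a - m%:~R - n%:~R * a1)%:A + (b - n%:~R * b1) *: x.
  by rewrite -!(mulr_algl _ x) -!in_algE !(rmorphB, rmorphM) !rmorph_int; ring.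
have [-> _] := normE (a - m%:~R - n%:~R * a1) (b - n%:~R * b1).
by rewrite -(rmorph1 (@ratr algC)) ltr_rat.
Qed.

(** An integer z of trace t and norm N with |z| < 2 has N <= 3.  If z is
    rational, it is 0, 1 or -1.  Otherwise the rows of the lattice Z + Z z are
    at distance sqrt(N - t^2 / 4), which is less than sqrt(3) unless t = 0 and
    N = 3; in that case z is a square root of -3 and the Eisenstein integer
    (1 + z) / 2 spans a finer lattice. *)
Lemma discretely_normed z : ~ norm_euclidean ->
  z \in @alg_integer K -> `|f z| < 2 -> [\/ z = 0, z = 1 | z = -1].
Proof.
move=> not_euclidean; have [a [b ->]] := coordinates z.
move=> z_int; rewrite -(@ltr_pXn2r _ 2) ?nnegrE //.
have [-> _] := normE a b.
have [t [N [tE NE]]] := alg_integer_trace_norm z_int.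
rewrite NE ratr_int -natrX -[(2 ^ 2)%N%:R]/(4%:~R) ltr_int => N_lt4.
have Dr_lt0 : (D%:~R : rat) < 0 by rewrite ltrz0.
have disc : - D%:~R * b ^+ 2 = N%:~R - t%:~R ^+ 2 / 4 :> rat.
  by rewrite -NE -tE; field.
have [b0 | b_neq0] := eqVneq b 0.
  have NtE : (t ^+ 2 = 4 * N)%R.
    apply/(@intr_inj rat); rewrite rmorphXn rmorphM /=.
    move: disc; rewrite b0 expr0n mulr0 => /eqP.
    by rewrite eq_sym subr_eq0 => /eqP; lra.
  have t_small : (-3 <= t <= 3)%R by apply/andP; split; nia.
  have t_cases : [\/ t = 0, t = 2 | t = -2].
    have : t \in [:: -3; -2; -1; 0; 1; 2; 3] by rewrite !inE; lia.
    rewrite !inE => /or4P[|||/or4P[|||]] /eqP tk; rewrite tk in NtE *;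
      by [lia | constructor].
  have aE : a = t%:~R / 2 by rewrite -tE; field.
  rewrite b0 scale0r addr0 aE; case: t_cases => ->.
  - by constructor 1; rewrite mul0r scale0r.
  - by constructor 2; rewrite divff // scale1r.
  - by constructor 3; rewrite rmorphN mulNr divff // scaleN1r.
have b2_gt0 : 0 < - D%:~R * b ^+ 2 by rewrite pmulr_lgt0 ?oppr_gt0 // exprn_even_gt0.
exfalso; apply: not_euclidean.
have [|] := boolP ((t == 0) && (N == 3)); last first.
  move=> tN; apply: norm_euclidean_lattice z_int _; rewrite b2_gt0 disc.
  have : 4 * N - t ^+ 2 < 12.
    have [t0|t_neq0] := eqVneq t 0; first by rewrite t0 in tN *; lia.
    have : 0 < t ^+ 2 by rewrite exprn_even_gt0.
    lia.
  rewrite -(ltr_int rat) rmorphB rmorphM rmorphXn /=; lra.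
case/andP=> /eqP t0 /eqP N3; rewrite t0 N3 mul0r subr0 in disc.
apply: (@norm_euclidean_lattice (1 / 2) (b / 2)); last first.
  by rewrite expr_div_n; move: disc; set u := b ^+ 2 => disc; lra.
apply/asboolP; exists ('X^2 - 'X + 1).
  rewrite monicE lead_coefDl ?lead_coefDl ?lead_coefXn //.
    by rewrite size_polyN size_polyX size_polyXn.
  by rewrite size_polyDl ?size_polyXn ?size_polyN ?size_polyX ?size_poly1.
rewrite /root !(rmorphD, rmorphB, rmorphN) /= map_polyXn map_polyX ?rmorph1 ?hornerE.
have y2 : (b *: x) ^+ 2 = - 3.
  rewrite exprZn x2 -ratr_int -alg_num_field scalerA.
  have -> : b ^+ 2 * D%:~R = - 3 by lra.
  by rewrite -in_algE rmorphN rmorph_nat.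
have two_neq0 : (2 : K) != 0 by rewrite -(rmorph_nat (in_alg K)) fmorph_eq0.
have -> : 2^-1%:A + (b / 2) *: x = (1 + b *: x) / 2.
  by rewrite -!(mulr_algl _ x) -!in_algE !(rmorphM, fmorphV) rmorph_nat /=; ring.
apply/eqP; set y := b *: x in y2 *.
have -> : ((1 + y) / 2) ^+ 2 - (1 + y) / 2 + 1 = (y ^+ 2 + 3) / 2 / 2 by field.
by rewrite y2 addNr !mul0r.
Qed.

Lemma norm_euclidean_domain :
  integral_domain (ring_of_integers K) -> norm_euclidean ->
  euclidean_domain (ring_of_integers K).
Proof.
move=> domain_O close; split=> //.
have normN (z : ring_of_integers K) : `|f (int_val z)| ^+ 2 \in Num.nat.
  case: z => z z_int /=; have [a [b zE]] := coordinates z; subst z.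
  have [nE _] := normE a b; have [t [N [_ NE]]] := alg_integer_trace_norm z_int.
  rewrite natrEint exprn_ge0 // andbT nE NE ratr_int; exact: intr_int.
exists (fun z => Num.truncn (`|f (int_val z)| ^+ 2)) => a b b_neq0.
have b_neq0' : int_val b != 0 by [].
have [c c_int c_close] := close (int_val a / int_val b).
exists (RingOfIntegers c_int), (a - RingOfIntegers c_int * b).
split; first by rewrite addrC subrK.
right; rewrite -(ltr_nat algC) !truncnK // ltr_pXn2r ?nnegrE //.
have -> : int_val (a - RingOfIntegers c_int * b)
    = (int_val a / int_val b - c) * int_val b.
  by rewrite mulrBl divfK.
by rewrite rmorphM normrM gtr_pMl // normr_gt0 fmorph_eq0.
Qed.

(** * Continued fractions with partial quotients of absolute value at least 2 *)

Section ContinuedFractions.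

Variable k : nat.
Implicit Types u v w : 'rV[K]_k.+2.

Let e0 : 'rV[K]_k.+2 := delta_mx 0 0.
Let e1 : 'rV[K]_k.+2 := delta_mx 0 1.

(** Consecutive convergents u, v of a continued fraction whose partial quotients
    after the first one have absolute value at least 2; the convergent p / q is
    the vector p e0 + q e1. *)
Inductive reduced : 'rV[K]_k.+2 -> 'rV[K]_k.+2 -> Prop :=
| ReducedStart c : c \in @alg_integer K -> reduced e0 (c *: e0 + e1)
| ReducedStep u v c : reduced u v -> c \in @alg_integer K -> 2 <= `|f c| ->
    reduced v (c *: v - u).

Definition reached (V : {vspace 'rV[K]_k.+2}) : Prop :=
  V = <[e0]>%VS \/ exists u v, reduced u v /\ V = <[v]>%VS.

Definition plane_det u v := u 0 0 * v 0 1 - u 0 1 * v 0 0.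

Definition unimodular u v :=
  [/\ integral_vector u, integral_vector v & plane_det u v = 1].

Let e01 : e0 0 1 = 0. Proof. by rewrite mxE. Qed.

Lemma integral_vector_comb c u v : c \in @alg_integer K ->
  integral_vector u -> integral_vector v -> integral_vector (c *: v + u).
Proof. by move=> c_int u_int v_int j; rewrite !mxE rpredD ?rpredM. Qed.

Lemma integral_vectorN v : integral_vector v -> integral_vector (- v).
Proof. by move=> v_int j; rewrite mxE rpredN; apply: v_int. Qed.

Lemma integral_delta j : integral_vector (delta_mx 0 j : 'rV[K]_k.+2).
Proof. by move=> l; rewrite mxE rpred_nat. Qed.

Lemma reduced_unimodular u v : reduced u v ->
  [/\ unimodular u v, u \in (<[e0]> + <[e1]>)%VS & v \in (<[e0]> + <[e1]>)%VS].
Proof.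
have e0_plane : e0 \in (<[e0]> + <[e1]>)%VS.
  exact/(subvP (addvSl _ _))/memv_line.
have e1_plane : e1 \in (<[e0]> + <[e1]>)%VS.
  exact/(subvP (addvSr _ _))/memv_line.
elim=> {u v} [c c_int|u v c _ [[u_int v_int uv] u_plane v_plane] c_int _].
  split=> //; last by rewrite memvD ?memvZ.
  split; [exact: integral_delta| |].
    by apply: integral_vector_comb => //; apply: integral_delta.
  by rewrite /plane_det !mxE /=; ring.
split=> //; last by rewrite memvB ?memvZ.
split=> //; first by apply: integral_vector_comb => //; apply: integral_vectorN.
by rewrite -uv /plane_det !mxE; ring.
Qed.

Hypothesis not_norm_euclidean : ~ norm_euclidean.

(** A continued fraction can be continued by any partial quotient c, up to
    rewriting it as a reduced one.  For |c| >= 2 it is reduced already, and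
    c = 0 is a step back.  For c = 1 or -1, the vector c v - u with
    v = c0 v' - u' and u = v' is, up to sign, (c0 - c) v' - u': the new
    partial quotient replaces the previous one, and induction applies. *)
Lemma reached_next u v c :
  reduced u v -> c \in @alg_integer K -> reached <[c *: v - u]>%VS.
Proof.
have lineN w : <[- w]>%VS = <[w]>%VS.
  apply/eqP; rewrite eqEsubv -!memvE memvN memv_line andTb.
  by rewrite -memvN memv_line.
move=> uv; elim: uv c => {u v} [c0 c0_int|u v c0 uv IH c0_int c0_ge2] c c_int.
  have [c_ge2|c_lt2] := boolP (2 <= `|f c|).
    right; exists (c0 *: e0 + e1), (c *: (c0 *: e0 + e1) - e0); split=> //.
    by apply: ReducedStep => //; apply: ReducedStart.
  have := discretely_normed not_norm_euclidean c_int.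
  rewrite real_ltNge ?realn // => /(_ c_lt2)[] -> {c c_int c_lt2}.
  - by left; rewrite scale0r sub0r lineN.
  - right; exists e0, ((c0 - 1) *: e0 + e1); split.
      by apply: ReducedStart; rewrite rpredB ?rpred1.
    by rewrite scale1r scalerBl scale1r addrAC.
  - right; exists e0, ((c0 + 1) *: e0 + e1); split.
      by apply: ReducedStart; rewrite rpredD ?rpred1.
    by rewrite scaleN1r -opprD lineN scalerDl scale1r addrAC.
have [c_ge2|c_lt2] := boolP (2 <= `|f c|).
  right; exists (c0 *: v - u), (c *: (c0 *: v - u) - v); split=> //.
  by apply: ReducedStep => //; apply: ReducedStep.
have := discretely_normed not_norm_euclidean c_int.
rewrite real_ltNge ?realn // => /(_ c_lt2)[] -> {c c_int c_lt2}.
- right; exists u, v; split=> //.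
  by rewrite scale0r sub0r lineN.
- have := IH (c0 - 1); rewrite rpredB ?rpred1 // => /(_ isT).
  by rewrite scale1r scalerBl scale1r addrAC.
- have := IH (c0 + 1); rewrite rpredD ?rpred1 // => /(_ isT).
  by rewrite scaleN1r -opprD lineN scalerDl scale1r addrAC.
Qed.

(** For <e0>, the vector -e1 plays the role of a convergent preceding e0. *)
Lemma reached_neighbours V : reached V -> exists u v,
  [/\ V = <[v]>%VS, unimodular u v, u \in (<[e0]> + <[e1]>)%VS
    & forall c, c \in @alg_integer K -> reached <[c *: v - u]>%VS].
Proof.
case=> [->|[u [v [uv ->]]]]; last first.
  have [uv1 u_plane _] := reduced_unimodular uv.
  by exists u, v; split=> // c; apply: reached_next.
exists (- e1), e0; split=> //.
- split; [exact/integral_vectorN/integral_delta|exact: integral_delta|].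
  by rewrite /plane_det !mxE /=; ring.
- by rewrite memvN; apply/(subvP (addvSr _ _))/memv_line.
- move=> c c_int; right; exists e0, (c *: e0 + e1); rewrite opprK; split=> //.
  exact: ReducedStart.
Qed.

(** With (p', q') the convergent after (p, q) and c0 the first partial quotient,
    |q'| >= 2 |q| - |q_prev| >= |q| + 1, and p' / q' differs from p / q by
    1 / |q q'|, which is at most 1 / |q| - 1 / |q'|; so the bound
    |p / q - c0| <= 1 - 1 / |q| persists.  It is stated without division. *)
Lemma reduced_bound u v : reduced u v ->
  `|f (u 0 1)| + 1 <= `|f (v 0 1)| /\
  exists2 c, c \in @alg_integer K & `|f (v 0 0 - c * v 0 1)| <= `|f (v 0 1)| - 1.
Proof.
elim=> {u v} [c c_int|u v c uv [q_grows [c0 c0_int c0_close]] c_int c_ge2].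
  have -> : (c *: e0 + e1) 0 1 = 1 by rewrite !mxE /= mulr0 add0r.
  have -> : (c *: e0 + e1) 0 0 = c by rewrite !mxE /= mulr1 addr0.
  rewrite e01 rmorph0 rmorph1 normr0 normr1.
  by split; [rewrite add0r|exists c => //; rewrite mulr1 subrr rmorph0 normr0 subrr].
have [[_ _ uv1] _ _] := reduced_unimodular uv.
set q := v 0 1 in q_grows c0_close *; set p := v 0 0 in c0_close *.
have vE j : (c *: v - u) 0 j = c * v 0 j - u 0 j by rewrite !mxE.
rewrite !vE -/p -/q.
have q'_grows : `|f q| + 1 <= `|f (c * q - u 0 1)|.
  rewrite rmorphB rmorphM.
  apply: le_trans (lerB_dist _ _); rewrite normrM lerBrDr -addrA [1 + _]addrC.
  apply: le_trans (_ : 2 * `|f q| <= _); last exact: ler_wpM2r.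
  by rewrite mulr_natl mulr2n lerD2l.
split=> //; exists c0 => //.
have q_gt0 : 0 < `|f q| by apply: lt_le_trans q_grows; rewrite ltr_wpDl.
rewrite -(ler_pM2r q_gt0) -normrM -rmorphM.
have -> : (c * p - u 0 0 - c0 * (c * q - u 0 1)) * q
    = (p - c0 * q) * (c * q - u 0 1) - 1.
  by rewrite -uv1 /plane_det -/p -/q; ring.
rewrite rmorphB rmorph1; apply: le_trans (ler_normB _ _) _.
rewrite normr1 rmorphM normrM.
apply: le_trans (_ : (`|f q| - 1) * `|f (c * q - u 0 1)| + 1 <= _).
  by rewrite lerD2r ler_wpM2r.
rewrite mulrBl mul1r [in leRHS]mulrBl mul1r [`|f q| * _]mulrC -addrA lerD2l.
by rewrite addrC lerBlDr addrC lerBrDr addrC.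
Qed.

Lemma unreached_line (w : K) :
  (forall c, c \in @alg_integer K -> 1 <= `|f (w - c)|) ->
  ~ reached <[w *: e0 + e1]>%VS.
Proof.
move=> w_far [].
  move=> E; have : w *: e0 + e1 \in <[e0]>%VS by rewrite -E memv_line.
  move=> /vlineP[a /rowP/(_ 1)]; rewrite !mxE /= !mulr0 add0r => /eqP.
  by rewrite oner_eq0.
move=> [u [v [uv E]]].
have : v \in <[w *: e0 + e1]>%VS by rewrite E memv_line.
case/vlineP=> a vE; have [q_grows [c c_int]] := reduced_bound uv.
have v1 : v 0 1 = a by rewrite vE !mxE /= mulr0 add0r mulr1.
have v0 : v 0 0 = a * w by rewrite vE !mxE /= addr0 mulr1.
rewrite v1 in q_grows *; rewrite v0 [c * a]mulrC -mulrBr rmorphM normrM => c_close.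
have a_ge1 : 1 <= `|f a|.
  by apply: le_trans q_grows; rewrite lerDr.
have : `|f a| * `|f (w - c)| < `|f a|.
  by apply: le_lt_trans c_close _; rewrite gtrBl.
rewrite gtr_pMr ?(lt_le_trans ltr01) //.
by apply/negP; rewrite -real_leNgt ?realn //; apply: w_far.
Qed.

(** Complete the generator v of L i to a basis u, v of the integral vectors of
    the plane.  The component of u along L i is c v with c integral, and its
    component along L j is u - c v, which spans L j. *)
Lemma reached_integral_apartment (L : 'I_k.+2 -> {vspace 'rV[K]_k.+2}) i j :
  line_decomposition L -> integral_decomposition L -> i != j ->
  (L i + L j)%VS = (<[e0]> + <[e1]>)%VS -> reached (L i) -> reached (L j).
Proof.
move=> [dimL directL _] L_integral ij planeE.
case/reached_neighbours=> u [v [LiE [u_int v_int uv] u_plane reached_v]].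
have [y [[y_L yE] _]] := L_integral u u_int.
have [a a_i [b b_j abE]] : exists2 a, a \in L i & exists2 b, b \in L j & u = a + b.
  by move: u_plane; rewrite -planeE => /memv_addP.
pose z l := if l == i then a else if l == j then b else 0.
have zE : u = \sum_l z l.
  rewrite (bigD1 i) //= (bigD1 j) 1?eq_sym //= big1 => [|l /andP[li lj]].
    by rewrite /z !eqxx eq_sym (negPf ij) addr0.
  by rewrite /z (negPf li) (negPf lj).
have yz : forall l, y l = z l.
  have z_L l : z l \in L l.
    by rewrite /z; case: eqP => [->|_] //; case: eqP => [->|_] //; apply: mem0v.
  have := directv_sum_unique directL y z (fun l _ => (y_L l).2) (fun l _ => z_L l).
  by rewrite -yE -zE eqxx => /esym/forall_inP y_z l; apply/eqP/y_z.
have [yi_int yi_L] := y_L i; have [yj_int yj_L] := y_L j.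
rewrite LiE in yi_L; case/vlineP: yi_L => c yiE.
have c_int : c \in @alg_integer K.
  (* The coefficient of v is read off by pairing with u, as det (u, v) = 1. *)
  have -> : c = plane_det u (y i).
    by rewrite yiE /plane_det !mxE !(mulrCA _ c) -mulrBr -/(plane_det u v) uv mulr1.
  by rewrite rpredB // rpredM.
have yjE : y j = u - c *: v.
  by rewrite -yiE !yz /z eqxx eq_sym (negPf ij) eqxx abE addrC addKr.
suff -> : L j = <[c *: v - u]>%VS by apply: reached_v.
have det_yj : plane_det v (c *: v - u) = 1.
  by rewrite -uv /plane_det !mxE; ring.
apply/eqP; rewrite eq_sym eqEdim dimL dim_vline -memvE -opprB -yjE memvN yj_L /=.
rewrite lt0b oppr_eq0; apply: contra_eq_neq det_yj => yj0.
rewrite -opprB -yjE yj0 /plane_det !mxE oppr0 !mulr0 subr0 eq_sym.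
exact: oner_neq0.
Qed.

End ContinuedFractions.
End QuadraticField.

(** * Additive maps on free abelian groups *)

Section Linear.

Variables (T : choiceType) (M : lmodType int).

Fact fglift_zmod (F : T -> M) : zmod_morphism (fglift F).
Proof. exact: lift_is_additive. Qed.

HB.instance Definition _ (F : T -> M) :=
  GRing.isZmodMorphism.Build {freeg T / int} M (fglift F) (fglift_zmod F).

Lemma additive_freegE (g : {additive {freeg T / int} -> M}) c :
  g c = \sum_(t <- dom c) coeff t c *: g << t >>.
Proof.
rewrite -{1}[c]freeg_sumE raddf_sum; apply: eq_bigr => t _.
by rewrite scale_int -raddfMz freeg_mulz -mulrzl intz mulr1.
Qed.

End Linear.

Lemma additive_freeg_ext (T : choiceType) (M : lmodType int)
    (g h : {additive {freeg T / int} -> M}) :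
  (forall t, g << t >> = h << t >>) -> g =1 h.
Proof.
by move=> gh c; rewrite !additive_freegE; apply: eq_bigr => t _; rewrite gh.
Qed.

(** * Subspaces spanned by lines of a frame *)

Section Lines.

Variables (K : fieldType) (n : nat) (L : 'I_n -> {vspace 'rV[K]_n}).
Hypothesis L_lines : line_decomposition L.

Lemma sub_sum_lines (I : {set 'I_n}) i :
  (L i <= \sum_(j in I) L j)%VS = (i \in I).
Proof.
have [dimL directL _] := L_lines.
apply/idP/idP => [Li_sub|iI]; last exact: sumv_sup iI (subvv _).
apply: contraT => i_notin.
have := directv_sumP directL i isT.
have /capv_idPl -> : (L i <= \sum_(j | true && (j != i)) L j)%VS.
  apply: subv_trans Li_sub _; apply/subv_sumP => j jI.
  by apply: sumv_sup (subvv _); apply: contraNneq i_notin => <-.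
by move/(congr1 (fun U : {vspace _} => \dim U)); rewrite dimL dimv0.
Qed.

Lemma sub_sum_sum (I J : {set 'I_n}) :
  (\sum_(i in I) L i <= \sum_(i in J) L i)%VS = (I \subset J).
Proof.
apply/subv_sumP/subsetP => sIJ i iI; last exact: sumv_sup (sIJ i iI) (subvv _).
by rewrite -sub_sum_lines sIJ.
Qed.

Lemma sum_lines_inj (I J : {set 'I_n}) :
  (\sum_(i in I) L i = \sum_(i in J) L i)%VS -> I = J.
Proof.
by move=> E; apply/eqP; rewrite eqEsubset -!sub_sum_sum E subvv.
Qed.

Lemma sum_lines_proper (I : {set 'I_n}) : I != set0 -> I != setT ->
  ((\sum_(i in I) L i)%VS != 0%VS) && ((\sum_(i in I) L i)%VS != fullv).
Proof.
have [dimL _ fullL] := L_lines.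
move=> I0 IT; apply/andP; split.
  apply: contra_neq I0 => E; apply: sum_lines_inj; rewrite E big_pred0 // => i.
  by rewrite inE.
apply: contra_neq IT => E; apply: sum_lines_inj; rewrite E -fullL.
by apply: eq_bigl => i; rewrite inE.
Qed.

End Lines.

(** * Simplices of the Tits building *)

Section Simplices.

Variables (K : fieldType) (n : nat).

Lemma lt_tits (U V : tits K n) : (U < V)%O -> (\dim (subspace U) < \dim (subspace V))%N.
Proof.
rewrite lt_neqAle => /andP[UV sUV].
have [le_dim ltE] := dimv_leqif_eq (sUV : (subspace U <= subspace V)%VS).
rewrite ltn_neqAle le_dim andbT ltE; apply: contra_neq UV; exact: val_inj.
Qed.

Lemma dim_tits (U : tits K n) : (0 < \dim (subspace U) < n)%N.
Proof.
have /andP[U0 UT] := valP U.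
rewrite lt0n dimv_eq0 U0 /=.
have [le_dim ltE] := dimv_leqif_eq (subvf (subspace U)).
by move: le_dim ltE; rewrite dimvf /dim /= mul1n ltn_neqAle => -> ->; rewrite UT.
Qed.

Lemma dim_simplex m (s : simplex (tits K n) m.+1) (j : 'I_m.+1) :
  (\dim (subspace (vertices s ord0)) + j <= \dim (subspace (vertices s j)))%N.
Proof.
case: j => j; elim: j => [|j IHj] j_lt.
  by rewrite addn0 (_ : Ordinal j_lt = ord0) //; apply: val_inj.
rewrite addnS; apply: leq_ltn_trans (IHj (ltnW j_lt)) _; apply: lt_tits.
by apply: (increasingP _ (valP s)).
Qed.

Lemma simplex_size m (s : simplex (tits K n) m.+1) :
  (\dim (subspace (vertices s ord0)) + m < n)%N.
Proof.
apply: leq_ltn_trans (dim_simplex s ord_max) _.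
by have /andP[] := dim_tits (vertices s ord_max).
Qed.

(** Dimensions grow strictly from at least 1 to at most n - 1 along a simplex.
    So homology classes of top degree are cycles. *)
Lemma chain_eq0 m (c : chain (tits K n) m.+1) : (n <= m.+1)%N -> c = 0.
Proof.
move=> n_le; rewrite -[c]freeg_sumE big1_seq // => s _.
have /andP[d0 _] := dim_tits (vertices s ord0).
by have := simplex_size s; lia.
Qed.

End Simplices.

(** * The cycle of an apartment *)

Section Flags.

Variables (K : fieldType) (k : nat) (L : 'I_k.+2 -> {vspace 'rV[K]_k.+2}).
Hypothesis L_lines : line_decomposition L.

(** A permutation s encodes the flag that the line L i enters at step s i.  With
    this convention, rather than its inverse, multiplying s by a transposition
    on the right exchanges two steps. *)
Definition below (s : 'S_k.+2) (j : nat) := [set i | s i <= j]%N.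

Lemma below_neq0 s j : below s j != set0.
Proof. by apply/set0Pn; exists (s^-1%g ord0); rewrite inE permKV. Qed.

Lemma below_neqT s (j : 'I_k.+1) : below s j != setT.
Proof.
apply/negP => /eqP/setP/(_ (s^-1%g ord_max)).
by rewrite !inE permKV /= leqNgt ltn_ord.
Qed.

Lemma below_proper s (i j : 'I_k.+1) : (i < j)%N -> below s i \proper below s j.
Proof.
move=> ij; apply/properP; split.
  by apply/subsetP => l; rewrite !inE => /leq_trans; apply; apply: ltnW.
exists (s^-1%g (widen_ord (leqnSn _) j)); rewrite inE permKV //=.
by rewrite -ltnNge.
Qed.

Definition flag_vertex s (j : 'I_k.+1) : tits K k.+2 :=
  Tits (sum_lines_proper L_lines (below_neq0 s j) (below_neqT s j)).

Fact flag_subproof s : increasing [ffun j => flag_vertex s j].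
Proof.
apply/increasingP => i j ij; rewrite !ffunE lt_leAnge.
by rewrite /Order.le /= /tits_le /= !sub_sum_sum // -properE below_proper.
Qed.

Definition flag s : simplex (tits K k.+2) k.+1 := Simplex (flag_subproof s).

Lemma flagE s j : subspace (vertices (flag s) j) = (\sum_(i in below s j) L i)%VS.
Proof. by rewrite ffunE. Qed.

Definition succ_tperm (i : 'I_k.+1) : 'S_k.+2 :=
  tperm (widen_ord (leqnSn _) i) (fintype.lift ord0 i).

(** Exchanging the lines that enter at steps i and i + 1 changes only the i-th
    vertex of a flag.  This pairs off the terms of opposite sign in the
    boundary of the signed sum of all flags. *)
Lemma face_flag_tperm s i : face i (flag (s * succ_tperm i)) = face i (flag s).
Proof.
apply/val_inj/ffunP => j; rewrite !ffunE; apply/val_inj => /=.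
apply: eq_bigl => l; rewrite !inE permM /succ_tperm.
have j_neq : bump i j != i by rewrite eq_sym neq_bump.
case: tpermP => [->|->|//] /=.
  by rewrite [bump 0 i]/=; move: (bump i j) j_neq; rewrite /bump /=; lia.
by move: (bump i j) j_neq; rewrite /bump /=; lia.
Qed.

Definition apartment_cycle : chain (tits K k.+2) k.+1 :=
  \sum_(s : 'S_k.+2) << (-1) ^+ s *g flag s >>.

Lemma boundary_simplex d (P : porderType d) m (a : int) (s : simplex P m.+1) :
  boundary << a *g s >> = \sum_(i < m.+1) << a * (-1) ^+ i *g face i s >>.
Proof.
rewrite [LHS]liftU scaler_sumr; apply: eq_bigr => i _.
by rewrite scale_int freeg_mulz -mulrzl intz.
Qed.

Lemma boundary_apartment_cycle : boundary apartment_cycle = 0.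
Proof.
rewrite raddf_sum /=.
under eq_bigr => s _ do rewrite boundary_simplex.
rewrite exchange_big big1 //= => i _; set S := \sum_s _.
have S_opp : S = - S.
  rewrite {1}/S (reindex_inj (mulIg (succ_tperm i))) -sumrN.
  apply: eq_bigr => s _; rewrite face_flag_tperm freegUN -mulNr; congr << _ * _ *g _ >>.
  rewrite odd_permM odd_tperm (_ : _ != _ = true) ?addbT ?signrN //.
  by apply/eqP => /(congr1 val) /=; rewrite /bump /=; lia.
apply/eqP/freeg_eqP => x; rewrite coeff0.
by have := congr1 (coeff x) S_opp; rewrite coeffN; lia.
Qed.

(** The subspaces of a flag other than its line determine the order in which all
    lines but the first two enter. *)
Lemma face_flag_eq s : face ord0 (flag s) = face ord0 (flag 1) ->
  forall i : 'I_k.+2, (2 <= i)%N -> s i = i.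
Proof.
move=> sE.
have below_s j : (0 < j < k.+1)%N -> below s j = below 1 j.
  case: j => // j /= j_lt; have jk : (j < k)%N := j_lt.
  have /(congr1 (fun t => subspace (vertices t (Ordinal jk)))) := sE.
  by rewrite !ffunE /= => /(sum_lines_inj L_lines).
move=> i i_ge2; apply/val_inj.
have le_s j : (0 < j < k.+1)%N -> (s i <= j)%N = (i <= j)%N.
  by move=> /below_s/setP/(_ i); rewrite !inE perm1.
have : (s i <= i.-1)%N = false by rewrite le_s; have := ltn_ord i; lia.
have [i_max|i_lt] := leqP k.+1 i; last first.
  have : (s i <= i)%N by rewrite le_s ?leqnn //; lia.
  rewrite /=; lia.
by rewrite /=; have := ltn_ord i; have := ltn_ord (s i); lia.
Qed.

End Flags.

(** * A functional on cycles that separates classes of lines *)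

Section Detection.

Variables (K : fieldType) (k : nat) (L0 : 'I_k.+2 -> {vspace 'rV[K]_k.+2}).
Hypothesis L0_lines : line_decomposition L0.
Variable C : {vspace 'rV[K]_k.+2} -> Prop.

Let i1 : 'I_k.+2 := fintype.lift ord0 ord0.
Let plane := (L0 ord0 + L0 i1)%VS.
Let tau := face ord0 (flag L0_lines 1%g).

Lemma dim_plane : (\dim plane <= 2)%N.
Proof.
have [dimL _ _] := L0_lines.
by have [] := dimv_add_leqif (L0 ord0) (L0 i1); rewrite !dimL.
Qed.

Lemma sub_plane (i : 'I_k.+2) : (i <= 1)%N -> (L0 i <= plane)%VS.
Proof.
move=> i_le1; have [->|i_neq0] := eqVneq i ord0; first exact: addvSl.
rewrite (_ : i = i1) ?addvSr //; apply/val_inj => /=.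
by move: i_neq0; rewrite -val_eqE /= /bump /=; lia.
Qed.

Lemma dim_first (s : simplex (tits K k.+2) k.+1) :
  \dim (subspace (vertices s ord0)) = 1%N.
Proof.
have /andP[dim_gt0 _] := dim_tits (vertices s ord0).
by have := simplex_size s; lia.
Qed.

(** If tau is not empty, its first vertex has dimension at least 2, while a
    complete flag starts with a line. *)
Lemma face_tau_ord0 (s : simplex (tits K k.+2) k.+1) (i : 'I_k.+1) :
  face i s = tau -> i = ord0.
Proof.
move=> sE; apply/val_inj/eqP; rewrite /= -leqn0 leqNgt; apply/negP => i_gt0.
have k_gt0 : (0 < k)%N by apply: leq_trans i_gt0 _; rewrite -ltnS.
have := congr1 (fun t => \dim (subspace (vertices t (Ordinal k_gt0)))) sE.
rewrite ![vertices (face _ _) _]ffunE.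
rewrite (_ : fintype.lift i _ = ord0) ?dim_first; last first.
  by apply: val_inj; rewrite /= /bump leqNgt i_gt0.
have := dim_simplex (flag L0_lines 1%g) (fintype.lift ord0 (Ordinal k_gt0)).
rewrite dim_first => dim_ge2 dimE; move: dim_ge2.
by rewrite -dimE.
Qed.

Lemma face0_tau (s : simplex (tits K k.+2) k.+1) :
  face ord0 s = tau -> (subspace (vertices s ord0) <= plane)%VS.
Proof.
move=> sE; have [k0|k_gt0] := posnP k.
  apply: subv_trans (subvf _) _; have [_ _ <-] := L0_lines.
  by apply/subv_sumP => i _; apply: sub_plane; have := ltn_ord i; lia.
pose j := fintype.lift ord0 (Ordinal k_gt0).
apply: (@subv_trans _ _ (subspace (vertices s j))).
  by have /(_ ord0 j isT)/ltW := increasingP _ (valP s).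
have -> : vertices s j = vertices (flag L0_lines 1%g) j.
  have := congr1 (fun t => vertices t (Ordinal k_gt0)) sE.
  by rewrite ![vertices (face _ _) _]ffunE.
rewrite flagE; apply/subv_sumP => i; rewrite inE perm1; exact: sub_plane.
Qed.

(** On cycles this is the residue map from the Steinberg module of K^n to the
    tensor product of those of the plane and of its quotient, evaluated on the
    indicator function of C and at the flag of the quotient given by tau. *)
Definition detect : chain (tits K k.+2) k.+1 -> int^o :=
  fglift (fun s => ((face ord0 s == tau) && `[< C (subspace (vertices s ord0)) >])%:R).

(** By [face_tau_ord0], tau arises from a complete flag only by deleting the
    line.  So for a cycle, whose boundary is 0, the coefficients at the complete
    flags extending tau add up to 0. *)
Lemma coeff_boundary_tau c :
  coeff tau (boundary c) = fglift (fun s => (face ord0 s == tau)%:R : int^o) c.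
Proof.
pose g : {additive chain (tits K k.+2) k.+1 -> int^o} := coeff tau \o @boundary _ _ _.
rewrite -[LHS]/(g c); apply: (@additive_freeg_ext _ _ g (fglift _)) => s /=.
rewrite liftU scale1r boundary_simplex raddf_sum big_ord_recl big1 => [|i _] /=.
  by rewrite addr0 coeffU !mul1r.
rewrite coeffU; case: eqP => [/face_tau_ord0 // | _]; by rewrite mulr0.
Qed.

(** The flags of an apartment that extend tau do so by lines L i contained in the
    plane of tau; two different ones span that plane.  By the hypothesis on C
    these lines are all in C or all outside C, so [detect] is either 0 or the sum of
    all coefficients at flags extending tau, which vanishes for a cycle. *)
Lemma detect_apartment (L : 'I_k.+2 -> {vspace 'rV[K]_k.+2})
    (z : chain (apartment L) k.+1) :
  line_decomposition L ->
  (forall i j, i != j -> (L i + L j)%VS = plane -> C (L i) -> C (L j)) ->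
  boundary z = 0 -> detect (chain_map (@apartment_vertex_lt K k.+2 L) z) = 0.
Proof.
move=> L_lines C_adj z0.
pose f := @apartment_vertex_lt K k.+2 L.
pose F (s : simplex (tits K k.+2) k.+1) := (face ord0 s == tau).
pose G (s : simplex (tits K k.+2) k.+1) := `[< C (subspace (vertices s ord0)) >].
have compE (H : simplex (tits K k.+2) k.+1 -> int^o) :
    fglift H (chain_map f z) = \sum_(s <- dom z) coeff s z *: H (simplex_map f s).
  rewrite -[LHS]/((fglift H \o @chain_map _ _ _ _ _ f k.+1) z) additive_freegE.
  by apply: eq_bigr => s _ /=; rewrite [chain_map _ _]liftU scale1r liftU scale1r.
have sum0 : \sum_(s <- dom z) coeff s z *: ((F (simplex_map f s))%:R : int^o) = 0.
  rewrite -(compE (fun s => (F s)%:R)) -coeff_boundary_tau chain_map_boundary.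
  by rewrite z0 raddf0 coeff0.
rewrite /detect compE.
have line_of (s : simplex (apartment L) k.+1) :
    exists i, subspace (vertices (simplex_map f s) ord0) = L i.
  have dim1 := dim_first (simplex_map f s).
  have := valP (vertices s ord0) => /existsP[I /and3P[/set0Pn[i iI] _ /eqP]].
  rewrite /= ffunE in dim1 *; move=> VE.
  exists i; apply/eqP; rewrite eq_sym eqEdim dim1 VE (sub_sum_lines L_lines) iI /=.
  by have [-> _ _] := L_lines.
have C_const s t : F (simplex_map f s) -> F (simplex_map f t) ->
    G (simplex_map f s) -> G (simplex_map f t).
  move=> Fs Ft /asboolP Cs; apply/asboolP; move: Cs.
  have [[i iE] [j jE]] := (line_of s, line_of t).
  have [Vs Vt] := (face0_tau (eqP Fs), face0_tau (eqP Ft)).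
  rewrite iE in Vs *; rewrite jE in Vt *.
  have [->//|ij] := eqVneq i j; apply: C_adj => //.
  apply/eqP; rewrite eqEdim subv_add Vs Vt /=; apply: leq_trans dim_plane _.
  have [dimL _ _] := L_lines.
  have [le_dim ltE] := dimv_leqif_eq (addvSl (L i) (L j)).
  rewrite dimL in le_dim ltE; rewrite ltn_neqAle le_dim andbT ltE.
  apply: contraNneq ij => LE; have := addvSr (L i) (L j); rewrite -LE.
  have := sub_sum_lines L_lines [set i] j; rewrite big_set1 inE => -> /eqP ->.
  exact: eqxx.
have [[s Fs Gs]|noG] := pselect (exists2 s, F (simplex_map f s) & G (simplex_map f s)).
  rewrite -[RHS]sum0; apply: eq_bigr => t _; rewrite -/(F _) -/(G _).
  have [Ft|//] := boolP (F (simplex_map f t)).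
  by rewrite (C_const s t Fs Ft Gs).
rewrite big1_seq // => s _; rewrite -/(F _) -/(G _).
have [Fs|] := boolP (F (simplex_map f s)); last by rewrite scaler0.
by have [Gs|] := boolP (G (simplex_map f s)); [case: noG; exists s|rewrite scaler0].
Qed.

(** The only flags of the apartment of L0 that extend tau are the standard one,
    whose line is not in C, and the one with the first two lines exchanged,
    which has sign -1. *)
Lemma detect_apartment_cycle :
  ~ C (L0 ord0) -> C (L0 i1) -> detect (apartment_cycle L0_lines) = -1.
Proof.
move=> nC0 C1; rewrite /detect raddf_sum /=.
have first_line (s : 'S_k.+2) i : s i = ord0 ->
    subspace (vertices (flag L0_lines s) ord0) = L0 i.
  move=> si; rewrite flagE (eq_bigl (pred1 i)) ?big_pred1_eq // => j.
  by rewrite inE leqn0 -[LHS]/(s j == ord0) -si (inj_eq perm_inj).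
rewrite (bigD1 (succ_tperm ord0)) //= big1 ?addr0 => [|s s_neq].
  rewrite liftU -{2}[succ_tperm _]mul1g face_flag_tperm eqxx.
  rewrite (first_line _ i1) ?tpermR; last by apply/val_inj.
  by rewrite (asboolT C1) odd_tperm /= expr1 scaleN1r.
rewrite liftU; have [/face_flag_eq s_fix|] := eqVneq; last by rewrite scaler0.
case: asboolP => [Cs|]; last by rewrite scaler0.
case/eqP: s_neq.
have s_lt2 (i : 'I_k.+2) : (i < 2)%N -> (s i < 2)%N.
  apply: contraTT; rewrite -!leqNgt => si_ge2.
  by rewrite -(perm_inj (s_fix _ si_ge2)).
have s0_neq0 : s ord0 != ord0.
  by apply/eqP => s0; apply: nC0; rewrite -(first_line s).
have s0 : s ord0 = i1.
  apply/val_inj; move: s0_neq0 (s_lt2 ord0 isT); rewrite -val_eqE /= /bump /=; lia.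
have s1 : s i1 = ord0.
  have : s i1 != s ord0 by rewrite (inj_eq perm_inj).
  apply: contraNeq; rewrite s0 -!val_eqE /= => s1; have := s_lt2 i1 isT.
  by move: s1; rewrite /bump /=; lia.
have widen0 : widen_ord (leqnSn k.+1) ord0 = ord0 by apply/val_inj.
apply/permP => i; rewrite /succ_tperm widen0.
case: tpermP => [->|->|/eqP i_neq0 /eqP i_neq1]; [exact: s0|exact: s1|].
apply: s_fix; move: i_neq0 i_neq1; rewrite -!val_eqE /= /bump /=; lia.
Qed.

(** [detect] vanishes on the classes in S but not on that of the apartment of L0.
    The degree m is kept apart from k because the Steinberg module of K^(k+2) is
    defined in degree k.+2 - 2, which is not convertible to k. *)
Lemma not_generated_by_unlinked_apartments m (mk : m = k)
    (S : reduced_homology (tits K k.+2) m -> Prop) :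
  ~ C (L0 ord0) -> C (L0 i1) ->
  (forall x, S x -> exists L (u : reduced_homology (apartment L) m),
    [/\ line_decomposition L,
        forall i j, i != j -> (L i + L j)%VS = plane -> C (L i) -> C (L j)
      & x = homology_map (@apartment_vertex_lt K k.+2 L) u]) ->
  ~ generated_by S.
Proof.
subst m => nC0 C1 S_apartment S_gen.
have z_cycle : apartment_cycle L0_lines \in @is_cycle _ (tits K k.+2) k.
  by rewrite unfold_in boundary_apartment_cycle.
have [m [a [x [Sx zE]]]] :=
  S_gen (\pi_(reduced_homology (tits K k.+2) k) (Cycle z_cycle)).
have /choice[y yP] : forall j, exists y : cycles (tits K k.+2) k,
    x j = \pi_(reduced_homology (tits K k.+2) k) y /\ detect (cycle_chain y) = 0.
  move=> j; have [L [u [L_lines C_adj xE]]] := S_apartment _ (Sx j).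
  pose z : cycles (apartment L) k := generic_quotient.repr u.
  exists (Defs.cycle_map (@apartment_vertex_lt K k.+2 L) z); split=> //.
  by apply: detect_apartment => //; apply/eqP/(valP z).
pose pr : {additive cycles (tits K k.+2) k -> reduced_homology (tits K k.+2) k} :=
  \pi_(reduced_homology (tits K k.+2) k).
pose y_sum : cycles (tits K k.+2) k := \sum_j y j *~ a j.
have : pr (Cycle z_cycle) = pr y_sum.
  rewrite [LHS]zE raddf_sum; apply: eq_bigr => j _.
  by have [-> _] := yP j; rewrite raddfMz.
move/eqP; rewrite -Quotient.idealrBE => /asboolP[c].
rewrite (chain_eq0 c) // raddf0 => /esym/eqP.
rewrite -[cycle_chain _]/(val (Cycle z_cycle - y_sum)) raddfB subr_eq0 => /eqP z_sum.
have := detect_apartment_cycle nC0 C1.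
rewrite /detect -[apartment_cycle _]/(val (Cycle z_cycle)) z_sum.
rewrite raddf_sum raddf_sum big1 //= => j _.
rewrite -[cycle_chain _]/(val (y j *~ a j)) !raddfMz.
by have [_ yj0] := yP j; rewrite [X in X *~ _](yj0 : fglift _ _ = 0) mul0rz.
Qed.

End Detection.
(** * A frame with two lines in different components *)

Section ShearedFrame.

Variables (K : fieldType) (k : nat) (w : K).

Let e (i : 'I_k.+2) : 'rV[K]_k.+2 := delta_mx 0 i.

Definition sheared_vector (i : 'I_k.+2) : 'rV[K]_k.+2 :=
  if i == ord0 then w *: e 0 + e 1 else if i == 1 then e 0 else e i.

Definition sheared_frame (i : 'I_k.+2) := <[sheared_vector i]>%VS.

Lemma sheared_frame_lines : line_decomposition sheared_frame.
Proof.
have dim1 i : \dim (sheared_frame i) = 1%N.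
  have e_neq0 j : e j != 0.
    by apply/eqP => /rowP/(_ j)/eqP; rewrite !mxE !eqxx oner_eq0.
  rewrite dim_vline /sheared_vector; case: (i == ord0); last first.
    by case: (i == 1); rewrite e_neq0.
  suff -> : w *: e 0 + e 1 != 0 by [].
  by apply/eqP => /rowP/(_ 1)/eqP; rewrite !mxE /= mulr0 add0r oner_eq0.
have sum_full : (\sum_i sheared_frame i)%VS = fullv.
  have frame_in i : sheared_vector i \in (\sum_i sheared_frame i)%VS.
    by rewrite memvE; apply: (sumv_sup i).
  have e0_in : e 0 \in (\sum_i sheared_frame i)%VS by have := frame_in 1.
  have e_in i : e i \in (\sum_i sheared_frame i)%VS.
    have := frame_in i; rewrite /sheared_vector; have [-> //|_] := eqVneq i ord0.
    have [-> _|//] := eqVneq i 1.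
    by have := frame_in 0; rewrite /sheared_vector eqxx rpredDl ?memvZ.
  apply/eqP; rewrite eqEsubv subvf; apply/subvP => v _; rewrite (row_sum_delta v).
  by apply: memv_suml => i _; rewrite memvZ ?e_in.
split=> //; rewrite directvE /= sum_full dimvf /dim /= mul1n.
by rewrite (eq_bigr _ (fun i _ => dim1 i)) sum1_card card_ord.
Qed.

Lemma sheared_plane :
  (sheared_frame 0%R + sheared_frame 1%R = <[e 0%R]> + <[e 1%R]>)%VS.
Proof.
rewrite /sheared_frame /sheared_vector /=; apply/eqP; rewrite eqEsubv !subv_add.
rewrite -!memvE.
have mem_sum (u v : 'rV[K]_k.+2) : (u \in <[u]> + <[v]>)%VS /\ (v \in <[u]> + <[v]>)%VS.
  by split; [apply: (subvP (addvSl _ _))|apply: (subvP (addvSr _ _))];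
     apply: memv_line.
have [e0_in e1_in] := mem_sum (e 0) (e 1).
have [w_in e0_in'] := mem_sum (w *: e 0 + e 1) (e 0).
rewrite memvD ?memvZ // e0_in e0_in' /=.
by rewrite rpredDl ?memvZ // in w_in.
Qed.

End ShearedFrame.

Theorem theorem1p1 (K : fieldExtType rat) (n : nat)
    (K_imaginary_quadratic : imaginary_quadratic K)
    (OK_pid : principal_ideal_domain (ring_of_integers K))
    (OK_not_euclidean : ~ euclidean_domain (ring_of_integers K))
    (n_ge2 : (2 <= n)%N) :
  ~ generated_by (@integral_apartment_class K n).
Proof.
case: n n_ge2 => [|[|k]] // _.
have [dimK [D [x [D_lt0 x2]]]] := K_imaginary_quadratic.
have [f [coordinates normE]] := quadratic_coordinates dimK D_lt0 x2.
have not_norm_euclidean : ~ norm_euclidean f.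
  move=> close; apply: OK_not_euclidean.
  by apply: norm_euclidean_domain coordinates normE _ close; case: OK_pid.
have [w w_far] : exists w : K, forall c, c \in @alg_integer K -> 1 <= `|f (w - c)|.
  apply: contrapT => /forallNP no_w; apply: not_norm_euclidean => w.
  apply: contrapT => no_c; apply: (no_w w) => c c_int.
  by rewrite real_leNgt ?realn //; apply/negP => c_close; apply: no_c; exists c.
have lift1 : fintype.lift ord0 ord0 = 1 :> 'I_k.+2 by apply/val_inj.
apply: (@not_generated_by_unlinked_apartments K k (sheared_frame w)
          (sheared_frame_lines k w) (@reached K f k)); rewrite ?lift1.
- by rewrite subn2.
- exact: unreached_line w_far.
- by left.
move=> y [L [L_lines L_integral [u _ ->]]]; exists L, u; split=> // i j ij planeE.
apply: (reached_integral_apartment D_lt0 x2 coordinates normE) => //.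
by rewrite planeE sheared_plane.
Qed.
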